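(* Let $\Omega\subset\mathbb{R}^d$ be a bounded domain and let $\delta>0$. Then there exists a constant $\lambda_{Pncr}=\lambda_{Pncr}(\overline{\overline{\Omega}},\delta)>0$ such that for every $u\in L_{2,0}(\overline{\overline{\Omega}})$, $$\lambda_{Pncr}\,\|u\|^2_{L_2(\overline{\overline{\Omega}})}\le a(u,u).$$
   Context: Functions are real-valued (scalar). Let $\delta>0$ (the horizon). The canonical kernel is $\chi_\delta(\mathbf{x}-\mathbf{x}')=1$ if $\|\mathbf{x}-\mathbf{x}'\|\le\delta$ (Euclidean norm) and $0$ otherwise. The nonlocal boundary of $\Omega$ is the region of thickness $\delta$ surrounding $\Omega$, $\mathcal{B}\Omega=\{\mathbf{x}\in\mathbb{R}^d\setminus\Omega:\operatorname{dist}(\mathbf{x},\Omega)\le\delta\}$, and the nonlocal closure of $\Omega$ is $\overline{\overline{\Omega}}:=\Omega\cup\mathcal{B}\Omega$. Set $L_{2,0}(\overline{\overline{\Omega}}):=\{v\in L_2(\overline{\overline{\Omega}}): v|_{\mathcal{B}\Omega}=0\}$. The bilinear form is $$a(u,v)=\frac12\int_{\overline{\overline{\Omega}}}\int_{\overline{\overline{\Omega}}}\chi_\delta(\mathbf{x}-\mathbf{x}')\,[u(\mathbf{x}')-u(\mathbf{x})]\,[v(\mathbf{x}')-v(\mathbf{x})]\,d\mathbf{x}'\,d\mathbf{x}.$$ *)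

(* Defs.v *)
From HB Require Import structures.
From mathcomp Require Import all_boot all_order all_algebra.
From mathcomp Require Import all_classical all_reals all_analysis.
Set Implicit Arguments.
Unset Strict Implicit.
Unset Printing Implicit Defensive.
Import Order.TTheory GRing.Theory Num.Theory.
Import numFieldNormedType.Exports.
Local Open Scope classical_set_scope.
Local Open Scope ring_scope.

(* Points of R^d are row vectors.  The library gives ['rV[R]_d] its usual
   topology through the sup norm; "open", "connected" and "bounded" mean the
   same for the Euclidean norm, which is [enorm] below and is the only norm
   used to measure lengths and distances. *)

Definition measure_rV_display : measure_display -> measure_display.
Proof. exact. Qed.

(* The Borel sigma-algebra of R^n, as the product of the Borel sigma-algebras
   of the coordinates (cf. the library instance on [n.-tuple T]). *)
Section measurable_rV.
Context {R : realType} (n : nat).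

Let coors : 'I_n -> 'rV[R]_n -> measurableTypeR R := fun i x => x ord0 i.

Let rV_set0 : g_sigma_preimage coors set0.
Proof. exact: sigma_algebra0. Qed.

Let rV_setC A : g_sigma_preimage coors A -> g_sigma_preimage coors (~` A).
Proof. exact: sigma_algebraC. Qed.

Let rV_bigcup (F : _^nat) : (forall i, g_sigma_preimage coors (F i)) ->
  g_sigma_preimage coors (\bigcup_i (F i)).
Proof. exact: sigma_algebra_bigcup. Qed.

HB.instance Definition _ := @isMeasurable.Build
  (measure_rV_display default_measure_display)
  'rV[R]_n (g_sigma_preimage coors) rV_set0 rV_setC rV_bigcup.

End measurable_rV.

Section lebesgue_rV.
Context {R : realType}.

Lemma measurable_coord n (i : 'I_n) :
  measurable_fun [set: 'rV[R]_n]
    ((fun x => x ord0 i) : 'rV[R]_n -> measurableTypeR R).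
Proof.
move=> _ Y mY; rewrite setTI; apply: sub_sigma_algebra => /=.
rewrite -bigcup_seq/=; exists i => /=; first by rewrite mem_index_enum.
by exists Y => //; rewrite setTI.
Qed.

Lemma measurable_fun_rV d (T : measurableType d) n (f : T -> 'rV[R]_n) :
  (forall i, measurable_fun [set: T]
     ((fun x => f x ord0 i) : T -> measurableTypeR R)) ->
  measurable_fun [set: T] f.
Proof.
move=> mf; apply: measurability => // _ [B + <-].
rewrite -bigcup_seq/= => -[i _] [C mC <-].
have := mf i measurableT C mC.
by rewrite /= !setTI.
Qed.

Definition consrV n (p : measurableTypeR R * 'rV[R]_n) : 'rV[R]_n.+1 :=
  \row_i (if unlift ord0 i is Some j then p.2 ord0 j else p.1).

Definition unconsrV n (x : 'rV[R]_n.+1) : measurableTypeR R * 'rV[R]_n :=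
  (x ord0 ord0, \row_j x ord0 (lift ord0 j)).

Lemma consrVK n : cancel (@consrV n) (@unconsrV n).
Proof.
move=> [a v]; rewrite /unconsrV /consrV mxE unlift_none /=; congr pair.
by apply/rowP => j; rewrite !mxE liftK.
Qed.

Lemma measurable_consrV n : measurable_fun setT (@consrV n).
Proof.
apply: measurable_fun_rV => i; rewrite /consrV.
under eq_fun do rewrite mxE.
case: (unlift ord0 i) => [j|]; last exact: measurable_fst.
exact: (measurableT_comp (measurable_coord j) measurable_snd).
Qed.

Lemma measurable_unconsrV n : measurable_fun setT (@unconsrV n).
Proof.
apply/measurable_fun_pairP; split; first exact: measurable_coord.
apply: measurable_fun_rV => i.
rewrite (_ : (fun _ => _) = fun x : 'rV[R]_n.+1 => x ord0 (lift ord0 i)).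
  exact: measurable_coord.
by apply/funext => x /=; rewrite mxE.
Qed.

Section consrV_measure.
Context n (mu : {sigma_finite_measure set 'rV[R]_n -> \bar R}).

Definition consrV_measure : set 'rV[R]_n.+1 -> \bar R :=
  pushforward (lebesgue_measure \x mu)%E (@consrV n).

HB.instance Definition _ := Measure.copy consrV_measure
  (@measure_function_pushforward__canonical__measure_function_Measure _ _ _ _ _
     (lebesgue_measure \x mu)%E _ (@measurable_consrV n)).

Let consrV_measure_sigma_finite : sigma_finite setT consrV_measure.
Proof.
have /sigma_finiteP[F [TF ndF Foo]] := sigma_finiteT (@lebesgue_measure R).
have /sigma_finiteP[G [TG ndG Goo]] := sigma_finiteT mu.
exists (fun k => @unconsrV n @^-1` (F k `*` G k)).
  rewrite -preimage_bigcup (_ : \bigcup_k _ = setT) ?preimage_setT//.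
  apply/seteqP; split => // -[x y] _.
  have: [set: measurableTypeR R] x by [].
  have: [set: 'rV[R]_n] y by [].
  rewrite TF TG => -[j _ Gjy] [i _ Fix].
  exists (maxn i j) => //; split.
  - by have /subsetPset := ndF _ _ (leq_maxl i j); exact.
  - by have /subsetPset := ndG _ _ (leq_maxr i j); exact.
move=> k; have [mF Fk] := Foo k; have [mG Gk] := Goo k; split.
  rewrite -[X in measurable X]setTI; apply: measurable_unconsrV => //.
  exact: measurableX.
rewrite /consrV_measure /pushforward -comp_preimage.
rewrite (_ : _ \o _ = idfun); last by apply/funext => x /=; exact: consrVK.
by rewrite preimage_id product_measure1E// lte_mul_pinfty// ge0_fin_numE.
Qed.

HB.instance Definition _ := Measure_isSigmaFinite.Build _ _ _ consrV_measure
  consrV_measure_sigma_finite.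

End consrV_measure.

(* Lebesgue measure on R^n, as the n-fold product of the Lebesgue measure on
   R: the unit mass on the one-point space R^0, then the image of
   lambda_1 \x lambda_n under (t, x) |-> (t, x_0, .., x_(n-1)). *)
Fixpoint lebesgue_rV n : {sigma_finite_measure set 'rV[R]_n -> \bar R} :=
  if n is m.+1 then consrV_measure (lebesgue_rV m)
  else \d_(0 : 'rV[R]_0).

Lemma lebesgue_rV_box n (A : 'I_n -> set (measurableTypeR R)) :
  (forall i, measurable (A i)) ->
  lebesgue_rV n [set x | forall i, A i (x ord0 i)] =
  (\prod_(i < n) lebesgue_measure (A i))%E.
Proof.
elim: n A => [|n IH] A mA.
  by rewrite big_ord0 /= diracE mem_set//= => -[].
rewrite big_ord_recl -IH//= /consrV_measure /pushforward.
rewrite -product_measure1E//; last first.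
  rewrite [X in measurable X](_ : _ = \big[setI/setT]_(i < n)
      ((fun x : 'rV[R]_n => x ord0 i) @^-1` A (lift ord0 i))); last first.
    apply/seteqP; split=> x; rewrite -bigcap_seq.
      by move=> xA i _; exact: xA.
    by move=> xA i; apply: xA; rewrite /= mem_index_enum.
  apply: bigsetI_measurable => i _; rewrite -[X in measurable X]setTI.
  exact: measurable_coord.
congr (product_measure1 _ _ _); apply/seteqP; split=> -[a v] /=.
  move=> h; split; first by have := h ord0; rewrite mxE unlift_none.
  by move=> i; have := h (lift ord0 i); rewrite mxE liftK.
move=> [Aa Av] i; rewrite mxE /=.
by case: unliftP => [j ->|->].
Qed.

End lebesgue_rV.

Section nonlocal.
Context {R : realType} {d : nat}.
Implicit Types (Omega D : set 'rV[R]_d) (delta : R) (x y : 'rV[R]_d).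
Implicit Types (u v : 'rV[R]_d -> R).

Definition enorm x : R := Num.sqrt (\sum_(i < d) x ord0 i ^+ 2).

Definition eucl_dist x Omega : R := inf [set enorm (x - y) | y in Omega].

Definition bounded_domain Omega : Prop :=
  [/\ Omega !=set0, open Omega, connected Omega & bounded_set Omega].

Definition nlboundary Omega delta : set 'rV[R]_d :=
  [set x | ~ Omega x /\ eucl_dist x Omega <= delta].

Definition nlclosure Omega delta : set 'rV[R]_d :=
  Omega `|` nlboundary Omega delta.

Definition chi delta x : R := if enorm x <= delta then 1 else 0.

(* Elements of L_2(D) are represented by functions on the whole space of which
   only the restriction to D matters: [u \_ D] is u on D and 0 elsewhere. *)
Definition L2 D : set ('rV[R]_d -> R) :=
  [set u | (u \_ D) \in Lfun (lebesgue_rV d) 2%:E].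

Definition L2norm D u : \bar R :=
  'N[lebesgue_rV d]_2%:E[EFin \o (u \_ D)]%E.

Definition L20 Omega delta : set ('rV[R]_d -> R) :=
  [set u | L2 (nlclosure Omega delta) u /\
     {ae lebesgue_rV d, forall x, nlboundary Omega delta x -> u x = 0}].

(* The bilinear form a(u, v), with D for the nonlocal closure of the domain. *)
Definition nlform D delta u v : \bar R :=
  ((2^-1)%:E * \int[lebesgue_rV d]_(x in D) \int[lebesgue_rV d]_(y in D)
     (chi delta (x - y) * (u y - u x) * (v y - v x))%:E)%E.

End nonlocal.

(* Main.v *)
Require Import Defs.
From mathcomp Require Import all_boot all_order all_algebra.
From mathcomp Require Import all_classical all_reals all_analysis.
From mathcomp Require Import measurable_realfun lra ring.
Set Implicit Arguments.
Unset Strict Implicit.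
Unset Printing Implicit Defensive.
Import Order.TTheory GRing.Theory Num.Theory.
Import numFieldNormedType.Exports.
Local Open Scope classical_set_scope.
Local Open Scope ring_scope.

(** Extend u by zero to a function w on the whole space, and put
    E(z) = int (w(x+z) - w(x))^2 dx.  Since w vanishes off Omega, substituting
    y = x + z and applying Tonelli gives 2 a(u,u) >= int_Q E(z) dz for every
    set Q of shifts of length at most delta.  By translation invariance
    E(2z) <= 4 E(z), hence E(2^k z) <= 4^k E(z); and if the shift by 2^k z moves
    the nonlocal closure off itself, then E(2^k z) >= int w^2.  Taking for Q the
    cube [c/2, c]^d with c = delta/d, one k serves for all z in Q, and the
    resulting constant depends on Omega only through a bound on its nonlocal
    closure. *)

(* [g] need not be measurable: this spares proving that the nonlocal closure
   is. *)
Lemma le_integral_nonmeasurable d (T : measurableType d) (R : realType)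
    (mu : {measure set T -> \bar R}) (f g : T -> \bar R) :
  (forall x, 0 <= f x)%E -> (forall x, f x <= g x)%E ->
  (\int[mu]_x f x <= \int[mu]_x g x)%E.
Proof.
move=> f0 fg.
rewrite !ge0_integralTE//; last by move=> x; exact: le_trans (f0 x) (fg x).
apply: ereal_sup_le => _ [h hf <-].
by exists h => // x; exact: le_trans (hf x) (fg x).
Qed.

(** * Translation invariance of Lebesgue measure on R^n *)

(** The image of Lebesgue measure under the translation gives each half-open interval its length,
    and this determines the measure. *)
Lemma integral_lebesgue_shift (R : realType) (t : R)
    (f : R -> \bar R) :
  measurable_fun [set: R] f -> (forall x, 0 <= f x)%E ->
  (\int[lebesgue_measure]_x f (x + t)%R = \int[lebesgue_measure]_x f x)%E.
Proof.
move=> mf f0.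
pose phi := (fun x => x + t) : measurableTypeR R -> measurableTypeR R.
have mphi : measurable_fun setT phi by exact: measurable_funD.
transitivity (\int[pushforward lebesgue_measure phi]_x f x)%E.
  by rewrite ge0_integral_pushforward.
apply: eq_measure_integral => A mA _; apply/esym.
pose nu := @measure_function_pushforward__canonical__measure_function_Measure
  _ _ _ _ _ (@lebesgue_measure R) _ mphi.
apply: (@lebesgue_measure_unique R nu) => // X [[a b] _ <-].
rewrite /nu/= /pushforward (_ : _ @^-1` _ = `](a - t), (b - t)]%classic).
  by rewrite !lebesgue_measure_itv/= !lte_fin ltrD2r -!EFinD opprB addrA subrK.
by apply/seteqP; split=> x; rewrite /= !in_itv/= ltrBlDr lerBrDr.
Qed.

Lemma measurable_rVD d (T : measurableType d) (R : realType) n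
    (f g : T -> 'rV[R]_n) : measurable_fun setT f -> measurable_fun setT g ->
  measurable_fun setT (fun x => f x + g x).
Proof.
move=> mf mg; apply: measurable_fun_rV => i.
under eq_fun do rewrite mxE.
by apply: measurable_funD;
  [exact: measurableT_comp (measurable_coord i) mf|
   exact: measurableT_comp (measurable_coord i) mg].
Qed.

Lemma integral_rVS (R : realType) n (f : 'rV[R]_n.+1 -> \bar R) :
  measurable_fun setT f -> (forall x, 0 <= f x)%E ->
  (\int[lebesgue_rV n.+1]_x f x =
   \int[lebesgue_measure]_t \int[lebesgue_rV n]_x f (consrV (t, x)))%E.
Proof.
move=> mf f0.
rewrite [LHS](ge0_integral_pushforward (@measurable_consrV R n))//.
rewrite fubini_tonelli1//; last by move=> x; exact: f0.
by apply: measurableT_comp mf _; exact: measurable_consrV.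
Qed.

Lemma consrVD (R : realType) n (t : R) (x : 'rV[R]_n) z :
  consrV (t, x) + z = consrV (t + (unconsrV z).1, x + (unconsrV z).2).
Proof.
apply/rowP => i; rewrite !mxE /=.
by case: unliftP => [j ->|->] //=; rewrite !mxE.
Qed.

(** By induction on the dimension: Tonelli splits off the first coordinate, the induction hypothesis
    absorbs the shift in the other coordinates, and the one-dimensional case absorbs the rest. *)
Lemma integral_rV_shift (R : realType) n (z : 'rV[R]_n)
    (f : 'rV[R]_n -> \bar R) :
  measurable_fun setT f -> (forall x, 0 <= f x)%E ->
  (\int[lebesgue_rV n]_x f (x + z)%R = \int[lebesgue_rV n]_x f x)%E.
Proof.
elim: n z f => [|n IH] z f mf f0.
  by apply: eq_integral => x _; rewrite [z]thinmx0 addr0.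
have mfc : measurable_fun setT (f \o @consrV R n).
  by apply: measurableT_comp mf _; exact: measurable_consrV.
rewrite !integral_rVS//; last first.
  by apply: measurableT_comp mf _; exact: measurable_rVD.
under eq_integral => t _.
  under eq_integral do rewrite consrVD.
  rewrite (IH _ (fun x => f (consrV (t + (unconsrV z).1, x))))//; last first.
    exact: (measurable_fun_pair2 _ mfc).
  over.
rewrite (@integral_lebesgue_shift _ _
  (fun t => \int[lebesgue_rV n]_x f (consrV (t, x)))%E)//.
  by apply: (measurable_fun_fubini_tonelli_F (f \o @consrV R n)) => // x;
    exact: f0.
by move=> t; exact: integral_ge0.
Qed.

(** * Energy of a shift *)

Definition shift_energy (R : realType) n (w : 'rV[R]_n -> R) (z : 'rV[R]_n) :=
  (\int[lebesgue_rV n]_x ((w (x + z) - w x) ^+ 2)%:E)%E.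

Lemma measurable_diff2 d (T : measurableType d) (R : realType) n
    (w : 'rV[R]_n -> R) (f g : T -> 'rV[R]_n) :
  measurable_fun setT w -> measurable_fun setT f -> measurable_fun setT g ->
  measurable_fun setT (fun x => ((w (f x) - w (g x)) ^+ 2)%:E).
Proof.
move=> mw mf mg; apply/measurable_EFinP; apply: measurable_funX.
by apply: measurable_funB; exact: measurableT_comp.
Qed.

(** The increment over [z + z] is a sum p + q of two increments over [z], whose squares have equal
    integrals by translation invariance; and (p + q)^2 <= 2 p^2 + 2 q^2. *)
Lemma shift_energy_double (R : realType) n (w : 'rV[R]_n -> R) z :
  measurable_fun setT w ->
  (shift_energy w (z + z) <= 4%:E * shift_energy w z)%E.
Proof.
move=> mw; rewrite /shift_energy.
have mD (a b : 'rV[R]_n) : measurable_fun setT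
    (fun x : 'rV[R]_n => ((w (x + a) - w (x + b)) ^+ 2)%:E).
  by apply: measurable_diff2 => //; exact: measurable_rVD.
have mD0 (a : 'rV[R]_n) : measurable_fun setT
    (fun x : 'rV[R]_n => ((w (x + a) - w x) ^+ 2)%:E).
  by apply: measurable_diff2 => //; exact: measurable_rVD.
apply: (@le_trans _ _ (\int[lebesgue_rV n]_x
  (2%:E * ((w (x + (z + z)) - w (x + z)) ^+ 2)%:E +
   2%:E * ((w (x + z) - w x) ^+ 2)%:E))%E).
  apply: le_integral_nonmeasurable => x; first by rewrite lee_fin sqr_ge0.
  rewrite -!EFinM -EFinD lee_fin -subr_ge0.
  set a := w _; set b := w _; set c := w _.
  rewrite [leRHS](_ : _ = (a - 2 * b + c) ^+ 2) ?sqr_ge0//; ring.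
rewrite ge0_integralD//; last 4 first.
- by move=> x _; rewrite lee_fin mulr_ge0// sqr_ge0.
- exact: measurable_funeM.
- by move=> x _; rewrite lee_fin mulr_ge0// sqr_ge0.
- exact: measurable_funeM.
rewrite !ge0_integralZl//; try by move=> x _; rewrite lee_fin sqr_ge0.
have /= := @integral_rV_shift _ _ z
  (fun x => ((w (x + z) - w x) ^+ 2)%:E) (mD0 z) (fun x => _).
under eq_integral do rewrite -addrA.
move=> ->; last by move=> x; rewrite lee_fin sqr_ge0.
by rewrite -ge0_muleDl ?lee_fin// -EFinD -natrD.
Qed.

Lemma shift_energy_iter (R : realType) n (w : 'rV[R]_n -> R) z k :
  measurable_fun setT w ->
  (shift_energy w (z *+ 2 ^ k) <= (4 ^+ k)%:E * shift_energy w z)%E.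
Proof.
move=> mw; elim: k => [|k IH]; first by rewrite expn0 mulr1n expr0 mul1e.
rewrite expnS mul2n -addnn mulrnDr.
apply: le_trans (shift_energy_double _ mw) _.
by rewrite exprS EFinM -muleA lee_wpmul2l.
Qed.

(** Where [w] is nonzero its increment over the long shift is [- w x], so the energy of that shift
    dominates the integral of w^2; reaching it by doublings costs 4^k. *)
Lemma le_shift_energy (R : realType) n (w : 'rV[R]_n -> R) z k :
  measurable_fun setT w ->
  (forall x, w x != 0 -> w (x + z *+ 2 ^ k) = 0) ->
  (((4 ^+ k)^-1)%:E * \int[lebesgue_rV n]_x (w x ^+ 2)%:E
     <= shift_energy w z)%E.
Proof.
move=> mw wz; have k0 : 0 < 4 ^+ k :> R by rewrite exprn_gt0.
rewrite lee_pdivrMl//; apply: le_trans _ (shift_energy_iter z k mw).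
apply: le_integral_nonmeasurable => x; rewrite lee_fin ?sqr_ge0//.
have [->|/wz ->] := eqVneq (w x) 0; first by rewrite expr0n sqr_ge0.
by rewrite sub0r sqrrN.
Qed.

(** In the variables x and z = y - x, Tonelli turns the double integral into the integral of the
    shift energy over [Q], where [le_shift_energy] gives a lower bound independent of z. *)
Lemma le_integral_diff2 (R : realType) n (w : 'rV[R]_n -> R) k
    (Q : set 'rV[R]_n) :
  measurable_fun setT w -> measurable Q ->
  (forall z, Q z -> forall x, w x != 0 -> w (x + z *+ 2 ^ k) = 0) ->
  (((4 ^+ k)^-1)%:E * lebesgue_rV n Q * \int[lebesgue_rV n]_x (w x ^+ 2)%:E
   <= \int[lebesgue_rV n]_x \int[lebesgue_rV n]_y
        (\1_Q (y - x) * (w y - w x) ^+ 2)%:E)%E.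
Proof.
move=> mw mQ wQ.
have m1 d (T : measurableType d) (g : T -> 'rV[R]_n) : measurable_fun setT g ->
    measurable_fun setT (fun x => \1_Q (g x) : R).
  by move=> mg; apply: measurableT_comp mg; exact: measurable_indic.
pose h (p : 'rV[R]_n * 'rV[R]_n) :=
  (\1_Q p.2 * (w (p.1 + p.2) - w p.1) ^+ 2)%:E.
have mh : measurable_fun setT h.
  apply/measurable_EFinP; apply: measurable_funM; first exact: m1.
  by apply/measurable_EFinP/measurable_diff2 => //; exact: measurable_rVD.
have h0 p : (0 <= h p)%E.
  by rewrite lee_fin mulr_ge0 ?sqr_ge0// indicE ler0n.
rewrite [leRHS](_ : _ =
    \int[lebesgue_rV n]_z \int[lebesgue_rV n]_x h (x, z))%E; last first.
  rewrite -fubini_tonelli//; apply: eq_integral => x _.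
  rewrite -[LHS](integral_rV_shift x)//.
  - by apply: eq_integral => z _; rewrite /h/= addrK [x + z]addrC.
  - apply/measurable_EFinP; apply: measurable_funM.
      by apply: m1; exact: measurable_rVD.
    by apply/measurable_EFinP/measurable_diff2.
  - by move=> y; rewrite lee_fin mulr_ge0 ?sqr_ge0// indicE ler0n.
pose W := (((4 ^+ k)^-1)%:E * \int[lebesgue_rV n]_x (w x ^+ 2)%:E)%E.
have W0 : (0 <= W)%E.
  apply: mule_ge0; first by rewrite lee_fin invr_ge0 exprn_ge0.
  by apply: integral_ge0 => x _; rewrite lee_fin sqr_ge0.
rewrite muleAC -/W.
rewrite -integral_cst// integral_mkcond.
apply: le_integral_nonmeasurable => z; rewrite patchE; case: ifPn => //.
rewrite inE => Qz; apply: le_trans (le_shift_energy mw (wQ _ Qz)) _.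
rewrite /shift_energy.
by under [leRHS]eq_integral do rewrite /h/= indicE mem_set// mul1r.
move=> _; apply: integral_ge0 => x _; exact: h0.
Qed.

(** * Norm bounds, cubes and the extent of the nonlocal closure *)

Lemma coord_le_enorm (R : realType) d (x : 'rV[R]_d) i : `|x ord0 i| <= enorm x.
Proof.
rewrite -sqrtr_sqr ler_wsqrtr// (bigD1 i)//= lerDl.
by apply: sumr_ge0 => j _; exact: sqr_ge0.
Qed.

Lemma enorm_le_coord (R : realType) d (x : 'rV[R]_d) c :
  0 <= c -> (forall i, `|x ord0 i| <= c) -> enorm x <= d%:R * c.
Proof.
move=> c0 xc; have dc0 : 0 <= d%:R * c by rewrite mulr_ge0.
rewrite -(ger0_norm dc0) -sqrtr_sqr ler_wsqrtr//.
apply: (@le_trans _ _ (\sum_(i < d) c ^+ 2)).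
  apply: ler_sum => i _.
  by rewrite -[leLHS]real_normK ?num_real// lerXn2r ?nnegrE.
rewrite sumr_const card_ord -[leLHS]mulr_natl exprMn ler_wpM2r ?sqr_ge0//.
by rewrite -natrX ler_nat; case: (d) => // n; exact: leq_pmulr.
Qed.

Lemma measurable_box (R : realType) n (A : 'I_n -> set (measurableTypeR R)) :
  (forall i, measurable (A i)) ->
  measurable [set x : 'rV[R]_n | forall i, A i (x ord0 i)].
Proof.
move=> mA; rewrite [X in measurable X](_ : _ = \big[setI/setT]_(i < n)
    ((fun x : 'rV[R]_n => x ord0 i) @^-1` A i)).
  apply: bigsetI_measurable => i _; rewrite -[X in measurable X]setTI.
  exact: measurable_coord.
apply/seteqP; split=> x; rewrite -bigcap_seq.
  by move=> xA i _; exact: xA.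
by move=> xA i; apply: xA; rewrite /= mem_index_enum.
Qed.

Lemma lebesgue_rV_cube (R : realType) n (a b : R) : a <= b ->
  lebesgue_rV n [set x | forall i, x ord0 i \in `[a, b]] = ((b - a) ^+ n)%:E.
Proof.
move=> ab; rewrite (lebesgue_rV_box (A := fun=> [set` `[a, b]]))//.
rewrite big_const iter_mule mule1 card_ord.
rewrite lebesgue_measure_itv/= lte_fin EFin_expe.
by case: ltgtP ab => //= -> _; rewrite subrr.
Qed.

Lemma mem_nlclosure (R : realType) d (Omega : set 'rV[R]_d) delta x y :
  Omega y -> enorm (x - y) <= delta -> nlclosure Omega delta x.
Proof.
move=> Oy xy; have [Ox|nOx] := pselect (Omega x); [by left|right; split=> //].
apply: le_trans _ xy; apply: ge_inf; last by exists y.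
by exists 0 => _ [z _ <-]; exact: sqrtr_ge0.
Qed.

Lemma bounded_coord_nlclosure (R : realType) d (Omega : set 'rV[R]_d) delta :
  Omega !=set0 -> bounded_set Omega -> 0 < delta ->
  exists2 M, 0 < M & forall x i, nlclosure Omega delta x -> `|x ord0 i| <= M.
Proof.
move=> [y0 Oy0] bO delta0; have [M M0 OM] := pinfty_ex_gt0 bO.
have OMi y i : Omega y -> `|y ord0 i| <= M.
  move=> /OM /=; apply: le_trans.
  rewrite [leRHS]/Num.Def.normr /= mx_normrE; apply/bigmax_geP; right => /=.
  by exists (ord0, i).
(* The infimum defining the distance need not be attained, so the slack 1 serves to find a point of
   [Omega] within [delta + 1]. *)
exists (M + (delta + 1)); first by rewrite !addr_gt0.
move=> x i [/OMi xM|[_ xd]].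
  by rewrite (le_trans (xM i))// lerDl !addr_ge0// ltW.
have [||_ [y Oy <-] xy] := @inf_lt _
  [set enorm (x - y) | y in Omega] (delta + 1).
- by exists (enorm (x - y0)), y0.
- by rewrite (le_lt_trans xd)// ltrDl.
rewrite -[x](subrK y) mxE addrC (le_trans (ler_normD _ _))// lerD ?OMi//.
exact: le_trans (coord_le_enorm _ _) (ltW xy).
Qed.

(** * From shift energies to the nonlocal form *)

Lemma L2norm_sqr (R : realType) d (D : set 'rV[R]_d) u :
  (L2norm D u ^+ 2 = \int[lebesgue_rV d]_x ((u \_ D) x ^+ 2)%:E)%E.
Proof.
have i0 : (0 <= \int[lebesgue_rV d]_x ((u \_ D) x ^+ 2)%:E)%E.
  by apply: integral_ge0 => x _; rewrite lee_fin sqr_ge0.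
rewrite /L2norm unlock.
under eq_integral => x _.
  rewrite /= powR_mulrn// real_normK ?num_real//.
  over.
by rewrite poweR12_sqrt// sqr_sqrte.
Qed.

Lemma L20_lower_bound (R : realType) d (Omega : set 'rV[R]_d) delta u k
    (Q : set 'rV[R]_d) :
  L20 Omega delta u -> measurable Q ->
  (forall z, Q z -> enorm z <= delta) ->
  (forall z, Q z -> forall x, nlclosure Omega delta x ->
     ~ nlclosure Omega delta (x + z *+ 2 ^ k)) ->
  ((2^-1)%:E * (((4 ^+ k)^-1)%:E * lebesgue_rV d Q) *
     L2norm (nlclosure Omega delta) u ^+ 2 <=
   nlform (nlclosure Omega delta) delta u u)%E.
Proof.
set D := nlclosure Omega delta; move=> [L2u [N [mN N0 uN]]] mQ Qdelta QD.
rewrite -muleA L2norm_sqr /nlform lee_pmul2l ?lte_fin ?invr_gt0//.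
have mu : measurable_fun setT (u \_ D).
  by have /sub_Lfun_mfun := L2u; rewrite inE/=.
(* Modified on the null set [N], the zero extension of [u] vanishes everywhere
   off [Omega], not just almost everywhere. *)
pose w := (u \_ D) \_ (~` N).
have mw : measurable_fun setT w.
  apply/(measurable_restrictT _ _).1; first exact: measurableC.
  exact: measurable_funS mu.
have wN x : ~ N x -> w x = (u \_ D) x by move=> nNx; rewrite /w patchE mem_set.
have wO x : w x != 0 -> Omega x.
  rewrite /w !patchE; case: ifPn; rewrite ?eqxx// inE => nNx.
  case: ifPn; rewrite ?eqxx// inE => -[//|Bx] /eqP ux.
  by exfalso; apply: nNx; apply: uN => /(_ Bx).
have wD x : ~ D x -> w x = 0.
  by move=> nDx; apply/eqP/negPn/negP => /wO Ox; apply: nDx; left.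
rewrite [X in (_ * X <= _)%E](_ : _ =
    \int[lebesgue_rV d]_x (w x ^+ 2)%:E)%E; last first.
  apply: ge0_ae_eq_integral => //.
  - by apply/measurable_EFinP; exact: measurable_funX.
  - by apply/measurable_EFinP; exact: measurable_funX.
  - by move=> x _; rewrite lee_fin sqr_ge0.
  - by move=> x _; rewrite lee_fin sqr_ge0.
  exists N; split => // x /= xN; apply: contrapT => nNx; apply: xN => _.
  by rewrite wN.
have Qw z : Q z -> forall x, w x != 0 -> w (x + z *+ 2 ^ k) = 0.
  by move=> Qz x /wO Ox; apply: wD; apply: QD => //; left.
apply: le_trans (le_integral_diff2 mw mQ Qw) _.
pose h (p : 'rV[R]_d * 'rV[R]_d) :=
  (\1_Q (p.2 - p.1) * (w p.2 - w p.1) ^+ 2)%:E.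
have h0 p : (0 <= h p)%E by rewrite lee_fin mulr_ge0 ?sqr_ge0// indicE ler0n.
have mh : measurable_fun setT h.
  apply/measurable_EFinP; apply: measurable_funM.
    apply: measurableT_comp; first exact: measurable_indic.
    apply: measurable_fun_rV => i; under eq_fun do rewrite !mxE.
    by apply: measurable_funB; apply: measurableT_comp (measurable_coord i) _.
  by apply/measurable_EFinP/measurable_diff2.
have mhN x : measurable_fun setT (fun y => h (x, y)).
  exact: measurable_fun_pair2 mh.
(* [N] is removed from the left side only, where measurability is known; the form is then compared
   pointwise. *)
rewrite (ge0_negligible_integral mN)//; last 2 first.
- exact: (measurable_fun_fubini_tonelli_F h).
- by move=> x _; apply: integral_ge0 => y _; exact: (h0 (x, y)).
rewrite setTD integral_mkcond [leRHS]integral_mkcond.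
apply: le_integral_nonmeasurable => x.
  rewrite patchE; case: ifPn => // _.
  by apply: integral_ge0 => y _; exact: (h0 (x, y)).
have form0 y : (0 <= (chi delta (x - y) * (u y - u x) * (u y - u x))%:E)%E.
  rewrite lee_fin -mulrA -expr2 mulr_ge0 ?sqr_ge0//.
  by rewrite /chi; case: ifP.
rewrite [leLHS]patchE; case: ifPn; last first.
  by move=> _; rewrite patchE; case: ifPn => // _; exact: integral_ge0.
rewrite inE => nNx.
rewrite (ge0_negligible_integral mN)//; last 2 first.
- exact: mhN.
- by move=> y _; exact: (h0 (x, y)).
rewrite setTD integral_mkcond.
(* A nonzero increment needs one of the two points in [Omega]; the other is then within [delta] of
   it, so both lie in [D]. *)
have hD y : ~ (D x /\ D y) -> h (x, y) = 0.
  move=> nD; rewrite /h /= indicE; case: (boolP (_ \in Q)); last first.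
    by rewrite mul0r.
  rewrite inE mul1r => /Qdelta yx.
  have xy : enorm (x - y) <= delta.
    rewrite (le_trans _ yx)// /enorm ler_wsqrtr// ler_sum// => i _.
    by rewrite !mxE -sqrrN opprB.
  have [wx|/wO Ox] := eqVneq (w x) 0; last first.
    by exfalso; apply: nD; split; [left|exact: mem_nlclosure Ox yx].
  have [wy|/wO Oy] := eqVneq (w y) 0; last first.
    by exfalso; apply: nD; split; [exact: mem_nlclosure Oy xy|left].
  by rewrite wx wy subrr expr0n.
rewrite patchE; case: ifPn; rewrite ?inE ?notin_setE => Dx; last first.
  rewrite le_eqVlt integral0_eq ?eqxx// => y _.
  by rewrite patchE; case: ifPn => // _; apply: hD => -[].
rewrite [leRHS]integral_mkcond; apply: le_integral_nonmeasurable => y.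
  by rewrite patchE; case: ifPn => // _; exact: (h0 (x, y)).
rewrite !patchE; case: ifPn; last by move=> _; case: ifPn.
rewrite inE => nNy; case: ifPn; rewrite ?inE ?notin_setE => Dy; last first.
  by rewrite -[leLHS]/(h (x, y)) hD// => -[].
rewrite /h/= !wN// !patchE !mem_set// -mulrA -expr2 lee_fin.
rewrite ler_wpM2r ?sqr_ge0// indicE /chi.
case: (boolP (_ \in Q)); last by case: ifP.
rewrite inE => /Qdelta yx; rewrite ifT// (le_trans _ yx)// /enorm ler_wsqrtr//.
by rewrite ler_sum// => i _; rewrite !mxE -sqrrN opprB.
Qed.

(** * Choice of the constant *)

Lemma poincare_of_bound (R : realType) d (M delta : R) :
  (0 < d)%N -> 0 < M -> 0 < delta -> exists2 l : R, 0 < l &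
    forall Omega (u : 'rV[R]_d -> R),
      (forall x i, nlclosure Omega delta x -> `|x ord0 i| <= M) ->
      L20 Omega delta u ->
      (l%:E * L2norm (nlclosure Omega delta) u ^+ 2
        <= nlform (nlclosure Omega delta) delta u u)%E.
Proof.
move=> d0 M0 delta0; pose c := delta / d%:R.
have c0 : 0 < c by rewrite divr_gt0// ltr0n.
have c20 : 0 < c / 2 by rewrite divr_gt0.
(* Shifts in the cube [Q] below have coordinates at least [c / 2]; after [k] doublings these exceed
   2M, the width of the box holding the nonlocal closure. The bound n < 2^n makes this [k] large
   enough. *)
pose k := Num.bound (2 * M / (c / 2)).
have kM : 2 * M < c / 2 * 2 ^+ k.
  rewrite [ltRHS]mulrC -ltr_pdivrMr// (lt_le_trans (archi_boundP _))//.
    by rewrite divr_ge0// ltW// mulr_gt0.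
  by rewrite -natrX ler_nat ltnW// ltn_expl.
pose Q := [set z : 'rV[R]_d | forall i, z ord0 i \in `[c / 2, c]].
(* The factors are the 1/2 of the form, the cost of the doublings and the volume of [Q]. *)
exists (2^-1 * ((4 ^+ k)^-1 * (c - c / 2) ^+ d)).
  rewrite mulr_gt0 ?invr_gt0// mulr_gt0 ?invr_gt0 ?exprn_gt0//.
  by rewrite subr_gt0; lra.
move=> Omega u OM Lu; rewrite !EFinM -(@lebesgue_rV_cube _ d); last by lra.
apply: L20_lower_bound => //.
- by apply: (measurable_box (A := fun=> [set` `[c / 2, c]])) => i;
    exact: measurable_itv.
- move=> z Qz; rewrite [leRHS](_ : _ = d%:R * c); last first.
    by rewrite /c mulrC divfK// pnatr_eq0 -lt0n.
  apply: enorm_le_coord; first exact: ltW.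
  move=> i; have := Qz i; rewrite in_itv/= => /andP[z1 z2].
  by rewrite ger0_norm// (le_trans _ z1)// ltW.
(* A single coordinate, available since [d] is positive, already takes the shifted point out of the
   box. *)
- move=> z Qz x /(OM _ (Ordinal d0)) x1 /(OM _ (Ordinal d0)).
  have := Qz (Ordinal d0); rewrite in_itv/= => /andP[z1 _].
  rewrite mxE mulmxnE -mulr_natr natrX; move: x1; rewrite !ler_norml.
  set a := x _ _; set b := z _ _ in z1 *; move=> /andP[x1 _] /andP[_ x2].
  have : c / 2 * 2 ^+ k <= b * 2 ^+ k by rewrite ler_wpM2r// exprn_ge0.
  lra.
Qed.

Theorem proposition1 (R : realType) (d : nat) (hd : (0 < d)%N) :
  exists lambda : set 'rV[R]_d -> R -> R,
    forall (Omega : set 'rV[R]_d) (delta : R),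
      bounded_domain Omega -> 0 < delta ->
      0 < lambda (nlclosure Omega delta) delta /\
      forall u : 'rV[R]_d -> R, L20 Omega delta u ->
        ((lambda (nlclosure Omega delta) delta)%:E
           * L2norm (nlclosure Omega delta) u ^+ 2
         <= nlform (nlclosure Omega delta) delta u u)%E.
Proof.
(* [lambda] sees only the nonlocal closure, so the constant must serve all
   domains sharing it. *)
pose good (D : set 'rV[R]_d) delta (l : R) := 0 < l /\
  forall Omega u, nlclosure Omega delta = D -> L20 Omega delta u ->
    (l%:E * L2norm D u ^+ 2 <= nlform D delta u u)%E.
(* The default 0 is taken only when no good constant exists, which is excluded below for bounded
   domains. *)
exists (fun D delta => xget 0 [set l | good D delta l]) => Omega delta.
move=> [neO _ _ bO] delta0.
suff : exists l, good (nlclosure Omega delta) delta l.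
  move=> [l gl]; have [? H] := xgetPex 0 (ex_intro _ l gl); split=> // u.
  exact: H.
have [M M0 DM] := bounded_coord_nlclosure neO bO delta0.
have [l l0 H] := poincare_of_bound hd M0 delta0.
exists l; split=> // Omega' u E Lu; rewrite -E; apply: H => // x i; rewrite E.
exact: DM.
Qed.
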